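(* Let $K$ be a metrizable compact Hausdorff space and let $\mathcal{B}=\bigcup_{j\in J}\mathcal{B}_j$ be a union of separating uniform subalgebras $\mathcal{B}_j$ of $\mathcal{C}(K)$. Then the minimal boundary $m_{\mathcal{B}}$ exists and $$m_{\mathcal{B}}=P_{\mathcal{B}}\quad\text{and}\quad \check{S}_{\mathcal{B}}=\overline{P_{\mathcal{B}}}.$$
   Context: $\mathcal{C}(K)$ is the algebra of complex-valued continuous functions on $K$ with the uniform norm. A uniform subalgebra of $\mathcal{C}(K)$ is a uniformly closed subalgebra containing the constants. A subset of $\mathcal{C}(K)$ is separating if for all distinct $x,y\in K$ it contains $f$ with $f(x)\neq f(y)$. For a set $\mathcal{A}$ of upper semi-continuous functions $K\to[-\infty,\infty)$ and $f\in\mathcal{A}$ put $S(f):=\{x\in K: f(x)=\max_K f\}$. A subset $S\subset K$ is a boundary for $\mathcal{A}$ if $S\cap S(f)\neq\emptyset$ for every $f\in\mathcal{A}$. The Shilov boundary $\check{S}_{\mathcal{A}}$ is the intersection of all closed boundaries for $\mathcal{A}$. The minimal boundary $m_{\mathcal{A}}$, if it exists, is a (not necessarily closed) boundary for $\mathcal{A}$ which is contained in every (not necessarily closed) boundary for $\mathcal{A}$. A point $x\in K$ is a peak point for $\mathcal{A}$ if there is $f\in\mathcal{A}$ with $S(f)=\{x\}$; $P_{\mathcal{A}}$ is the set of all peak points for $\mathcal{A}$. For $\mathcal{B}\subset\mathcal{C}(K)$ put $\log|\mathcal{B}|:=\{\log|f|: f\in\mathcal{B}\}$ (with $\log 0=-\infty$),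 and write $\check{S}_{\mathcal{B}}, m_{\mathcal{B}}, P_{\mathcal{B}}$ for $\check{S}_{\log|\mathcal{B}|}, m_{\log|\mathcal{B}|}, P_{\log|\mathcal{B}|}$. *)

(* Defs.v *)
From HB Require Import structures.
From mathcomp Require Import all_boot all_order all_algebra.
From mathcomp Require Import all_classical all_reals all_analysis.
From mathcomp Require Export complex.
Export numFieldNormedType.Exports.

Set Implicit Arguments.
Unset Strict Implicit.
Unset Printing Implicit Defensive.

Import Order.TTheory GRing.Theory Num.Theory.

Local Open Scope classical_set_scope.
Local Open Scope ring_scope.

Definition metrizable (R : realType) (K : topologicalType) : Prop :=
  exists d : K -> K -> R,
    [/\ forall x y, 0 <= d x y,
        forall x y, d x y = 0 <-> x = y,
        forall x y, d x y = d y x,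
        forall x y z, d x z <= d x y + d y z &
        forall x, nbhs x =
          filter_from [set e : R | 0 < e] (fun e => [set y | d x y < e])].

(* The alias ^o is what gives the complex field R[i] its norm topology. *)
Definition subalgebra (R : realType) (K : topologicalType)
    (B : set (K -> R[i]^o)) : Prop :=
  [/\ forall f, B f -> continuous f,
      forall f g, B f -> B g -> B (f \+ g),
      forall (c : R[i]) f, B f -> B (c \*: f) &
      forall f g, B f -> B g -> B (f \* g)].

Definition uniform_subalgebra (R : realType) (K : topologicalType)
    (B : set (K -> R[i]^o)) : Prop :=
  [/\ subalgebra B,
      forall c : R[i]^o, B (cst c) &
      forall f : K -> R[i]^o, continuous f ->
        closure (B : set {uniform K -> R[i]^o}) f -> B f].

Definition separating (R : realType) (K : topologicalType)
    (B : set (K -> R[i]^o)) : Prop :=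
  forall x y : K, x <> y -> exists2 f, B f & f x <> f y.

Definition max_points (R : realType) (K : topologicalType)
    (f : K -> \bar R) : set K :=
  [set x | forall y, (f y <= f x)%E].

(* In this and the next definitions, the functions in A are meant to be upper
   semicontinuous and < +oo, as those of log_abs B are. *)
Definition boundary (R : realType) (K : topologicalType)
    (A : set (K -> \bar R)) (S : set K) : Prop :=
  forall f, A f -> S `&` max_points f !=set0.

Definition shilov_boundary (R : realType) (K : topologicalType)
    (A : set (K -> \bar R)) : set K :=
  \bigcap_(S in [set S | closed S /\ boundary A S]) S.

Definition is_minimal_boundary (R : realType) (K : topologicalType)
    (A : set (K -> \bar R)) (m : set K) : Prop :=
  boundary A m /\ forall S, boundary A S -> m `<=` S.

Definition peak_points (R : realType) (K : topologicalType)
    (A : set (K -> \bar R)) : set K :=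
  [set x | exists2 f, A f & max_points f = [set x]].

(* lne sends 0 to -oo. *)
Definition log_abs (R : realType) (K : topologicalType)
    (B : set (K -> R[i]^o)) : set (K -> \bar R) :=
  [set (fun x => lne (Normc.normc (f x))%:E) | f in B].

(* Main.v *)
(* The max set of |f| contains a peak point of every separating uniform algebra
   containing f (Bishop).  By compactness and metrizability, countable
   intersections of peak sets reach a minimal peak set inside any given one.  A
   nonconstant g on a peak set E cuts out the smaller set {g = g(x0)}, where
   |g(x0)| = max_E |g|; it is again a peak set, since (1 + g / g(x0)) / 2 peaks
   there relative to E.  So minimal peak sets are points.  Peak points lie in
   every boundary, and the peak points of the union are those of the B_j. *)
Require Import Defs.
From HB Require Import structures.
From mathcomp Require Import all_boot all_order all_algebra.
From mathcomp Require Import all_classical all_reals all_analysis.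
From mathcomp Require Import finmap ring lra.

Set Implicit Arguments.
Unset Strict Implicit.
Unset Printing Implicit Defensive.

Import Order.TTheory GRing.Theory Num.Theory.
Import Normc.

Local Open Scope classical_set_scope.
Local Open Scope ring_scope.

(** * Modulus and uniformity of the complex field *)

Lemma normcB (R : rcfType) (x y : R[i]) : normc (x - y) = normc (y - x).
Proof. by rewrite -normcN opprB. Qed.

Lemma normc_ge0 (R : rcfType) (x : R[i]) : 0 <= normc x.
Proof. by case: x => a b; exact: sqrtr_ge0. Qed.

Lemma normcX (R : rcfType) (x : R[i]) n : normc (x ^+ n) = normc x ^+ n.
Proof.
by elim: n => [|n IH]; rewrite ?expr0 ?normc1 // !exprS normcM IH.
Qed.

Lemma normc_real (R : rcfType) (r : R) : 0 <= r -> normc (r%:C)%C = r.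
Proof. by move=> r0; rewrite /= expr0n /= addr0 sqrtr_sqr ger0_norm. Qed.

Lemma ler_dist_normc (R : rcfType) (x y : R[i]) :
  `|normc x - normc y| <= normc (x - y).
Proof.
have D (u v : R[i]) : normc u - normc v <= normc (u - v).
  by rewrite lerBlDr (le_trans _ (le_normcD _ _)) // subrK.
by rewrite ler_norml D lerNl opprB normcB D.
Qed.

Lemma normc_le_ReIm (R : rcfType) (z : R[i]) :
  normc z <= `|complex.Re z| + `|complex.Im z|.
Proof.
case: z => a b /=.
rewrite -[leRHS]ger0_norm ?addr_ge0 // -[leRHS]sqrtr_sqr ler_wsqrtr //.
rewrite sqrrD !real_normK ?num_real // lerD2r lerDl.
by rewrite mulrn_wge0 ?mulr_ge0.
Qed.

Lemma Re_le_normc (R : rcfType) (z : R[i]) : `|complex.Re z| <= normc z.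
Proof. by case: z => a b /=; rewrite -[leLHS]sqrtr_sqr ler_wsqrtr // lerDl sqr_ge0. Qed.

Lemma Im_le_normc (R : rcfType) (z : R[i]) : `|complex.Im z| <= normc z.
Proof. by case: z => a b /=; rewrite -[leLHS]sqrtr_sqr ler_wsqrtr // lerDr sqr_ge0. Qed.

Lemma ltc_normc (R : rcfType) (z : R[i]) (e : R) :
  (`|z| < (e%:C)%C) = (normc z < e).
Proof. exact: ltcR. Qed.

Lemma continuous_normc (R : realType) (K : topologicalType) (f : K -> R[i]^o) :
  continuous f -> continuous (fun x => normc (f x)).
Proof.
move=> cf x; apply/cvgrPdist_lt => e e0.
have e0c : 0 < (e%:C)%C :> R[i] by rewrite ltcR.
move: (cf x) => /cvgrPdist_lt /(_ _ e0c).
apply: filterS => t; rewrite ltc_normc.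
exact/le_lt_trans/ler_dist_normc.
Qed.

Lemma entourage_normc (R : realType) (A : set (R[i]^o * R[i]^o)) :
  entourage A ->
  exists2 e : R, 0 < e & forall x y, normc (x - y) < e -> A (x, y).
Proof.
rewrite -entourage_ballE => -[[a b]] /=.
(* A positive element of [R[i]] has zero imaginary part, so the radius is a real number. *)
rewrite ltcE /= => /andP[/eqP b0 a0]; subst b => sub.
exists a => // x y xy; apply: sub => /=.
by rewrite -ball_normE /ball_ /= (ltc_normc _ a).
Qed.

Lemma normc_entourage (R : realType) (e : R) : 0 < e ->
  entourage [set xy : R[i]^o * R[i]^o | normc (xy.1 - xy.2) < e].
Proof.
move=> e0; rewrite -entourage_ballE; exists (e%:C)%C; rewrite /= ?ltcR //.
by move=> [x y] /=; rewrite -ball_normE /ball_ /= ltc_normc.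
Qed.

(** * Uniform limits in a uniform subalgebra *)

Section uniform_limits.
Variables (R : realType) (K : topologicalType) (B : set (K -> R[i]^o)).
Hypothesis uB : uniform_subalgebra B.

(** The closedness clause of [uniform_subalgebra] speaks of continuous functions, so continuity of
    [f] comes first, by an [e / 3] argument. *)
Lemma uniform_subalgebra_lim (f : K -> R[i]^o) :
  (forall e : R, 0 < e ->
     exists2 g, B g & forall x, normc (f x - g x) < e) -> B f.
Proof.
move=> H; have [[cB _ _ _] _ clB] := uB.
apply: clB => [x|].
  apply/cvg_app_entourageP => A entA.
  have [e e0 eA] := entourage_normc entA.
  have e30 : 0 < e / 3 by rewrite divr_gt0.
  have [g Bg fg] := H _ e30.
  have gx : \forall y \near x, normc (g x - g y) < e / 3.
    have /cvg_app_entourageP := cB _ Bg x.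
    by move=> /(_ _ (normc_entourage e30)).
  apply: filterS gx => y gxy; apply: eA.
  have -> : f x - f y = (f x - g x) + ((g x - g y) + (g y - f y)).
    by rewrite addrA !subrKA.
  apply: le_lt_trans (le_normcD _ _) _.
  apply: le_lt_trans (lerD (lexx _) (le_normcD _ _)) _.
  have := fg x; have := fg y; rewrite (normcB (f y)).
  lra.
move=> P /uniform_nbhs [A [entA AP]].
have [e e0 eA] := entourage_normc entA.
have [g Bg fg] := H _ e0.
by exists g; split=> //; apply: AP => y _; exact: eA.
Qed.

(** The limit is taken separately in the real and imaginary parts. Each contributes an error of at
    most [e m], whence the factor 2. *)
Lemma uniform_subalgebra_complete (s : nat -> K -> R[i]^o) (e : nat -> R) :
  (forall n, B (s n)) -> e @ \oo --> 0 ->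
  (forall m n x, (m <= n)%N -> normc (s n x - s m x) <= e m) ->
  exists2 q, B q & forall m x, normc (q x - s m x) <= e m *+ 2.
Proof.
move=> Bs e0 sC.
(* [P] will be the real part, then the imaginary part: both are additive and bounded by the
   modulus. *)
have limP (P : R[i] -> R) (PD : {morph P : x y / x - y})
    (PN : forall z, `|P z| <= normc z) x m :
    `|lim ((fun n => P (s n x)) @ \oo) - P (s m x)| <= e m.
  have cP : cvgn (fun n => P (s n x)).
    apply/cauchy_cvgP/cauchy_exP => eps eps0.
    have [N _ HN] := (cvgrPdist_lt _ _).1 e0 _ eps0.
    exists (P (s N x)); exists N => // n /= Nn.
    rewrite -ball_normE /= distrC -PD (le_lt_trans (PN _)) //.
    rewrite (le_lt_trans (sC _ _ _ Nn)) //.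
    have := HN N (leqnn N); rewrite sub0r normrN.
    exact/le_lt_trans/ler_norm.
  have cP' : (fun n => `|P (s n x) - P (s m x)|) @ \oo -->
      `|lim ((fun n => P (s n x)) @ \oo) - P (s m x)|.
    by apply: cvg_norm; apply: cvgB => //; exact: cvg_cst.
  rewrite -(cvg_lim _ cP') //; apply: limr_le.
    by apply/cvg_ex; eexists; exact: cP'.
  near=> n; rewrite -PD (le_trans (PN _)) // sC //.
  by near: n; exact: nbhs_infty_ge.
pose q x : R[i]^o := (lim ((fun n => complex.Re (s n x)) @ \oo) +i*
   lim ((fun n => complex.Im (s n x)) @ \oo))%C.
have qs m x : normc (q x - s m x) <= e m *+ 2.
  rewrite (le_trans (normc_le_ReIm _)) // mulr2n.
  have -> : complex.Re (q x - s m x) =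
    lim ((fun n => complex.Re (s n x)) @ \oo) - complex.Re (s m x).
    by rewrite /q; case: (s m x).
  have -> : complex.Im (q x - s m x) =
    lim ((fun n => complex.Im (s n x)) @ \oo) - complex.Im (s m x).
    by rewrite /q; case: (s m x).
  apply: lerD; apply: limP.
  - by move=> [? ?] [? ?].
  - exact: Re_le_normc.
  - by move=> [? ?] [? ?].
  - exact: Im_le_normc.
exists q => //; apply: uniform_subalgebra_lim => eps eps0.
have eps20 : 0 < eps / 2 by rewrite divr_gt0.
have [N _ HN] := (cvgrPdist_lt _ _).1 e0 _ eps20.
exists (s N) => // x; rewrite (le_lt_trans (qs _ _)) //.
have := HN N (leqnn N); rewrite sub0r normrN => /(le_lt_trans (ler_norm _)).
by rewrite -mulr_natr; lra.
Unshelve. all: by end_near. Qed.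

End uniform_limits.

(** * Geometric series with weights [2^-(i+1)] *)

Lemma cvg_geometric2 (R : realType) (k : R) :
  (fun n => k * 2^-1 ^+ n) @ \oo --> 0.
Proof.
have := @cvg_geometric R k 2^-1; apply.
by rewrite ger0_norm ?invr_ge0 // invf_lt1 ?ltr1n.
Qed.

Lemma ler_geometric2 (R : realType) (a c k : R) (N : nat) :
  (forall n, (N <= n)%N -> a <= c + k * 2^-1 ^+ n) -> a <= c.
Proof.
move=> H; apply/ler_addgt0Pr => e e0.
have [m _ Hm] := (cvgrPdist_lt _ _).1 (cvg_geometric2 k) _ e0.
apply: le_trans (H (maxn N m) (leq_maxl _ _)) _.
rewrite lerD2l; have := Hm (maxn N m) (leq_maxr _ _).
by rewrite sub0r normrN => /ltW; exact/le_trans/ler_norm.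
Qed.

Lemma sum_geometric2 (R : realFieldType) (n : nat) :
  \sum_(i < n) 2^-1 ^+ i.+1 = 1 - 2^-1 ^+ n :> R.
Proof.
elim: n => [|n IH]; first by rewrite big_ord0 expr0 subrr.
by rewrite big_ord_recr /= IH exprS; lra.
Qed.

Section geometric_series.
Variables (R : realType) (K : topologicalType) (B : set (K -> R[i]^o)).
Hypothesis uB : uniform_subalgebra B.

Lemma uniform_subalgebra_sum (c : nat -> R[i]) (f : nat -> K -> R[i]^o) n :
  (forall i, B (f i)) -> B (fun x => \sum_(i < n) c i * f i x).
Proof.
have [[_ BD BZ _] Bc _] := uB; move=> Bf.
elim: n => [|n IH].
  have -> : (fun x => \sum_(i < 0) c i * f i x) = cst 0 by
    apply/funext => x; rewrite big_ord0.
  exact: Bc.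
have -> : (fun x => \sum_(i < n.+1) c i * f i x) =
    (fun x => \sum_(i < n) c i * f i x) \+ (c n \*: f n).
  by apply/funext => x; rewrite big_ord_recr.
exact/BD/BZ/Bf.
Qed.

(** [q] is the sum of the [2^-(i+1) f_i]. The weights add up to 1, so [q] keeps any value common to
    all [f_i]. The second clause passes to the limit a bound valid for all large partial sums. *)
Lemma uniform_subalgebra_series (f : nat -> K -> R[i]^o) (M : R) :
  (forall n, B (f n)) -> (forall n x, normc (f n x) <= M) ->
  exists2 q, B q & forall x,
    (forall v, (forall n, f n x = v) -> q x = v) /\
    (forall c N, (forall n, (N <= n)%N ->
       \sum_(i < n) 2^-1 ^+ i.+1 * normc (f i x) <= c) -> normc (q x) <= c).
Proof.
move=> Bf fM.
pose w i : R[i] := ((2^-1 ^+ i.+1)%:C)%C.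
have nw i : normc (w i) = 2^-1 ^+ i.+1.
  by rewrite normc_real // exprn_ge0.
pose s n x : R[i]^o := \sum_(i < n) w i * f i x.
have Bs n : B (s n) by exact: uniform_subalgebra_sum.
have ns n x : normc (s n x) <= \sum_(i < n) 2^-1 ^+ i.+1 * normc (f i x).
  elim: n => [|n IH]; first by rewrite /s !big_ord0 normc0.
  rewrite /s !big_ord_recr /= (le_trans (le_normcD _ _)) //.
  by rewrite lerD // normcM nw.
have sC m n x : (m <= n)%N -> normc (s n x - s m x) <= M * 2^-1 ^+ m.
  (* Subtracting [M * 2^-1 ^+ n] makes the bound telescope, so that the induction on [n - m]
     closes. *)
  move=> mn; suff : normc (s n x - s m x) <= M * 2^-1 ^+ m - M * 2^-1 ^+ n.
    move/le_trans; apply; rewrite gerBl mulr_ge0 ?exprn_ge0 //.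
    exact: le_trans (normc_ge0 _) (fM 0 x).
  rewrite -(subnK mn); elim: (n - m)%N => [|k IH].
    by rewrite add0n !subrr normc0.
  rewrite addSn /s big_ord_recr /= -/(s _ _) addrAC.
  apply: le_trans (le_normcD _ _) _; apply: le_trans (lerD IH (lexx _)) _.
  rewrite normcM nw.
  have := ler_wpM2l (exprn_ge0 (k + m).+1 (_ : 0 <= 2^-1 :> R)) (fM (k + m)%N x).
  by rewrite invr_ge0 ler0n => /(_ isT); rewrite exprS; lra.
have [q Bq qs] := uniform_subalgebra_complete uB Bs (cvg_geometric2 M) sC.
exists q => // x; split=> [v fv|c N fc].
  apply/eqP; rewrite -subr_eq0; apply/eqP/eq0_normc/eqP.
  rewrite eq_le normc_ge0 andbT.
  (* [M * 2] accounts for the distance from [q] to [s n], and [normc v] for the weight [2^-n] still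
     missing from [s n]. *)
  apply: (@ler_geometric2 _ _ _ (M * 2 + normc v) 0%N) => n _.
  have -> : q x - v = (q x - s n x) + (s n x - v) by rewrite subrKA.
  have -> : s n x - v = - (((2^-1 ^+ n)%:C)%C * v).
    rewrite /s (eq_bigr (fun i : 'I_n => w i * v)) => [|i _]; last by rewrite fv.
    rewrite -mulr_suml /w -rmorph_sum sum_geometric2 rmorphB rmorph1.
    by rewrite mulrBl mul1r addrAC subrr add0r.
  apply: le_trans (le_normcD _ _) _; rewrite normcN normcM.
  rewrite normc_real ?exprn_ge0 //.
  by have := qs n x; rewrite -mulr_natr; lra.
apply: (@ler_geometric2 _ _ _ (M * 2) N) => n Nn.
rewrite -[q x](subrK (s n x)).
apply: le_trans (le_normcD _ _) _.
have := qs n x; have := ns n x; have := fc n Nn; rewrite -mulr_natr; lra.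
Qed.

End geometric_series.

(** * Estimates that force a modulus below 1 *)

(** The map sends the unit disc to the disc with diameter [0, 1], which meets the unit circle only
    at 1. *)
Lemma normc_midpoint1 (R : rcfType) (w : R[i]) : normc w <= 1 ->
  normc ((1 + w) / 2) <= 1 /\ (normc ((1 + w) / 2) = 1 -> w = 1).
Proof.
move=> w1; have n2 : normc (2 : R[i]) = 2.
  by have := @normc_real R 2 (ler0n _ _); rewrite rmorph_nat.
rewrite normcM normcV n2; split.
  rewrite ler_pdivrMr // mul1r (le_trans (le_normcD _ _)) // normc1; lra.
move=> /(congr1 ( *%R^~ 2)); rewrite divfK // mul1r => H.
case: w w1 H => a b /=.
rewrite add0r => ab H.
have: a ^+ 2 + b ^+ 2 <= 1.
  by rewrite -(@ler_sqrt _ _ 1) // sqrtr1.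
have : (1 + a) ^+ 2 + b ^+ 2 = 4.
  by rewrite -[LHS]sqr_sqrtr ?H ?addr_ge0 ?sqr_ge0 // expr2; lra.
move=> H1 H2; have a1 : a = 1 by have := sqr_ge0 b; nra.
have : b ^+ 2 <= 0 by rewrite a1 in H1; nra.
rewrite exprn_even_le0 //= => /eqP ->.
by rewrite a1.
Qed.

Section weighted_bounds.
Variable R : realFieldType.
Implicit Types u : nat -> R.

(** The weights add up to at most 1, and the term of index [m] falls short of its weight by the
    subtracted amount. One index with [u m < 1] thus gives a bound below 1 independent of [n]. *)
Lemma weighted_sum_lt1 u m : (forall i, u i <= 1) -> forall n, (m < n)%N ->
  \sum_(i < n) 2^-1 ^+ i.+1 * u i <= 1 - 2^-1 ^+ m.+1 * (1 - u m).
Proof.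
move=> u1 n mn.
suff H : \sum_(i < n) 2^-1 ^+ i.+1 * u i <=
    1 - 2^-1 ^+ n - 2^-1 ^+ m.+1 * (1 - u m).
  by apply: le_trans H _; rewrite lerD2r gerBl exprn_ge0.
rewrite -(subnK mn); elim: (n - m.+1)%N => [|k IH].
  rewrite add0n big_ord_recr /=.
  suff : \sum_(i < m) 2^-1 ^+ i.+1 * u i <= 1 - 2^-1 ^+ m.
    by rewrite exprS; lra.
  rewrite -sum_geometric2; apply: ler_sum => i _.
  by rewrite ler_piMr // exprn_ge0.
rewrite addSn big_ord_recr /=; apply: le_trans (lerD IH (lexx _)) _.
have : 2^-1 ^+ (k + m.+1).+1 * u (k + m.+1)%N <= 2^-1 ^+ (k + m.+1).+1.
  by rewrite ler_piMr // exprn_ge0.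
by rewrite exprS; lra.
Qed.

(** The first [m] weights add up to [1 - 2^-m] and all later ones to at most [2^-m]. *)
Lemma weighted_sum_le u m (b : R) :
  (forall i, (i < m)%N -> u i <= b) -> (forall i, (m <= i)%N -> u i <= 2^-1) ->
  forall n, (m <= n)%N -> \sum_(i < n) 2^-1 ^+ i.+1 * u i <=
    b * (1 - 2^-1 ^+ m) + 2^-1 * 2^-1 ^+ m.
Proof.
move=> ub u2 n mn.
suff H : \sum_(i < n) 2^-1 ^+ i.+1 * u i <=
    b * (1 - 2^-1 ^+ m) + 2^-1 * (2^-1 ^+ m - 2^-1 ^+ n).
  apply: le_trans H _; rewrite lerD2l ler_wpM2l ?invr_ge0 //.
  by rewrite gerBl exprn_ge0.
rewrite -(subnK mn); elim: (n - m)%N => [|k IH].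
  rewrite add0n subrr mulr0 addr0 -sum_geometric2 mulr_sumr.
  apply: ler_sum => i _; rewrite mulrC ler_wpM2r ?exprn_ge0 //.
  exact: ub.
rewrite addSn big_ord_recr /=; apply: le_trans (lerD IH (lexx _)) _.
have := ler_wpM2l (exprn_ge0 (k + m).+1 (_ : 0 <= 2^-1 :> R))
  (u2 (k + m)%N (leq_addl _ _)).
by rewrite invr_ge0 ler0n => /(_ isT); rewrite exprS; lra.
Qed.

End weighted_bounds.

Lemma compact_max_continuous (R : realType) (K : topologicalType)
    (f : K -> R) (A : set K) :
  A !=set0 -> compact A -> continuous f ->
  exists2 c, A c & forall t, A t -> f t <= f c.
Proof.
move=> A0 cA cf.
have [c /set_mem Ac H] := compact_EVT_max A0 cA (continuous_subspaceT cf).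
by exists c => // t /mem_set /H.
Qed.

(** * Peaking functions and extension from a peak set *)

Section peaking.
Variables (R : realType) (K : topologicalType).
Implicit Types (B : set (K -> R[i]^o)) (p g h : K -> R[i]^o).

(** Asking for the value 1, and not only modulus 1, makes the product of [h] with any power of [p]
    agree with [h] on the peak set. *)
Definition peaking B p :=
  [/\ B p, forall x, normc (p x) <= 1, forall x, normc (p x) = 1 -> p x = 1 &
      exists x, p x = 1].

Definition peak_set p : set K := [set x | p x = 1].

Hypothesis Kc : compact [set: K].

Lemma closed_compact (A : set K) : closed A -> compact A.
Proof. by move=> cA; apply: subclosed_compact cA Kc _. Qed.

Lemma closed_peak_set p : continuous p ->
  (forall x, normc (p x) <= 1) -> (forall x, normc (p x) = 1 -> p x = 1) ->
  closed (peak_set p).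
Proof.
move=> cp p1 pE.
have -> : peak_set p = (fun x => normc (p x)) @^-1` [set 1].
  apply/seteqP; split=> x /=; last exact: pE.
  by rewrite /peak_set /= => ->; rewrite normc1.
apply: preimage_closed; last exact: closed_eq.
by move=> ? _; exact: continuous_normc.
Qed.

(** The set where [|h| >= 1 + e] is compact and misses the peak set, so [|p|] has a maximum below 1
    on it. Powers of that maximum beat the maximum of [|h|]. *)
Lemma peak_power_small p h (e : R) : continuous p -> continuous h ->
  (forall x, normc (p x) <= 1) -> (forall x, normc (p x) = 1 -> p x = 1) ->
  (forall x, p x = 1 -> normc (h x) <= 1) -> 0 < e ->
  exists k, forall x, 1 + e <= normc (h x) ->
    normc (h x * p x ^+ k.+1) <= 2^-1.
Proof.
move=> cp ch p1 pE hE e0.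
pose A := [set x | 1 + e <= normc (h x)].
have cA : compact A.
  apply: closed_compact; rewrite (_ : A =
    (fun x => normc (h x)) @^-1` [set r | 1 + e <= r]) //.
  apply: preimage_closed; last exact: closed_ge.
  by move=> ? _; exact: continuous_normc.
have [A0|/set0P/negP/negPn/eqP A0] := pselect (A !=set0); last first.
  exists 0%N => x hx; have : A x by []; by rewrite A0.
have [c Ac pc] := compact_max_continuous A0 cA (continuous_normc cp).
have [d Ad hd] := compact_max_continuous A0 cA (continuous_normc ch).
have r1 : normc (p c) < 1.
  rewrite lt_neqAle p1 andbT; apply/eqP => /pE /hE.
  by have := Ac; rewrite /A /= => /le_trans H /H; lra.
have := @cvg_geometric R (normc (h d)) (normc (p c)).
rewrite ger0_norm ?normc_ge0 // => /(_ r1) /cvgrPdist_lt /(_ 2^-1).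
rewrite invr_gt0 ltr0n => /(_ isT) [k _ Hk]; exists k => x hx.
have := Hk k.+1 (leqnSn k); rewrite sub0r normrN => /ltW.
move=> /(le_trans (ler_norm _)); apply: le_trans.
rewrite /geometric /= normcM normcX.
by rewrite ler_pM ?exprn_ge0 ?normc_ge0 ?hd // lerXn2r ?nnegrE ?normc_ge0 // pc.
Qed.

Lemma uniform_subalgebraX B p n : uniform_subalgebra B -> B p ->
  B (fun x => p x ^+ n).
Proof.
move=> [[_ _ _ BM] Bc _] Bp; elim: n => [|n IH].
  by rewrite (_ : (fun _ => _) = cst 1) //; apply/funext => x; rewrite expr0.
rewrite (_ : (fun _ => _) = p \* (fun x => p x ^+ n)); first exact: BM.
by apply/funext => x; rewrite exprS.
Qed.

(* Bishop's series: with h bounded by 1 on the peak set of p, the k_n damp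
   h p^k_n below 1/2 wherever |h| >= 1 + 2^-(n+2), so that the average of
   these functions is of modulus < 1 off the peak set of p. *)
Lemma peaking_extension B p h : uniform_subalgebra B -> peaking B p -> B h ->
  (forall x, p x = 1 -> normc (h x) <= 1) ->
  (exists2 q, B q & (forall x, p x = 1 -> q x = h x) /\
    (forall x, p x <> 1 -> normc (q x) < 1)).
Proof.
move=> uB [Bp p1 pE [x0 px0]] Bh hE.
have [[Bcont _ _ BM] _ _] := uB.
have /choice[k Hk] : forall n, exists k, forall x,
    1 + 2^-1 ^+ n.+2 <= normc (h x) -> normc (h x * p x ^+ k.+1) <= 2^-1.
  move=> n; apply: peak_power_small => //; try exact: Bcont.
pose f n x : R[i]^o := h x * p x ^+ (k n).+1.
have [M HM] : exists M, forall x, normc (h x) <= M.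
  have [c _ Hc] := @compact_max_continuous R K (fun x => normc (h x)) setT
    (ex_intro _ x0 I) Kc (continuous_normc (Bcont _ Bh)).
  by exists (normc (h c)) => x; exact: Hc.
have fh n x : normc (f n x) <= normc (h x).
  rewrite normcM normcX ler_piMr ?normc_ge0 //.
  by rewrite exprn_ile1 ?normc_ge0.
have Bf n : B (f n).
  rewrite (_ : f n = h \* (fun x => p x ^+ (k n).+1)) //.
  by apply: BM => //; exact: uniform_subalgebraX.
have fM n x : normc (f n x) <= M by apply: le_trans (fh n x) (HM x).
have [q Bq qP] := uniform_subalgebra_series uB Bf fM.
exists q => //; split=> [x px|x npx].
  by apply: (qP x).1 => n; rewrite /f px expr1n mulr1.
have px1 : normc (p x) < 1.
  by rewrite lt_neqAle p1 andbT; apply/eqP => /pE.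
have [h1|h1] := lerP (normc (h x)) 1.
  have f1 i : normc (f i x) <= 1 by apply: le_trans (fh i x) h1.
  (* The exponents [(k n).+1] are positive, so already the term of index 0 has modulus at most
     [|p x| < 1]. *)
  have := @weighted_sum_lt1 R (fun i => normc (f i x)) 0%N f1.
  move=> /((qP x).2 _ 1%N) /le_lt_trans; apply.
  rewrite gtrBl mulr_gt0 ?exprn_gt0 ?invr_gt0 // subr_gt0.
  rewrite normcM normcX; apply: le_lt_trans px1.
  rewrite -[leRHS]mul1r ler_pM ?exprn_ge0 ?normc_ge0 //.
  by rewrite exprS ler_piMr ?normc_ge0 // exprn_ile1 ?normc_ge0.
have ex : exists n, 1 + 2^-1 ^+ n.+2 <= normc (h x).
  have e0 : 0 < normc (h x) - 1 by rewrite subr_gt0.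
  have [n _ Hn] := (cvgrPdist_lt _ _).1 (cvg_geometric2 1) _ e0.
  exists n; have := Hn n.+2 (ltnW (leqnSn _)).
  rewrite sub0r normrN mul1r => /(le_lt_trans (ler_norm _)); lra.
(* The thresholds decrease, so from this least [m] on every term is damped below 1/2. Minimality
   bounds [|h x|] by the preceding threshold. *)
case: (ex_minnP ex) => m Hm mmin.
have ub i : (i < m)%N -> normc (f i x) <= normc (h x) by [].
have u2 i : (m <= i)%N -> normc (f i x) <= 2^-1.
  move=> mi; apply: Hk; apply: le_trans Hm; rewrite lerD2l.
  by rewrite ler_wiXn2l ?invr_ge0 ?invf_le1 ?ler1n.
have := @weighted_sum_le R (fun i => normc (f i x)) m _ ub u2.
move=> /((qP x).2 _ m) /le_lt_trans; apply.
case: m Hm mmin {ub u2} => [|m] Hm mmin.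
  by rewrite expr0; lra.
have : normc (h x) < 1 + 2^-1 ^+ m.+2.
  by rewrite ltNge; apply/negP => /mmin; rewrite ltnn.
(* Now [|h x| < 1 + e/2], so the bound is less than [(1 + e/2)(1 - e) + e/2 = 1 - e^2/2]. This is
   why the thresholds use the exponent [n.+2]. *)
rewrite exprS; set e := 2^-1 ^+ m.+1; move=> he.
have e0 : 0 < e by rewrite exprn_gt0 // invr_gt0.
have e1 : e < 1 by rewrite exprn_ilt1 ?invr_ge0 // invf_lt1 ?ltr1n.
nra.
Qed.

End peaking.

(** * Minimal peak sets are points *)

Section peak_sets.
Variables (R : realType) (K : topologicalType).
Hypothesis Kc : compact [set: K].

Lemma compact_decreasing_nonempty (E : nat -> set K) :
  (forall n, closed (E n)) -> (forall n, E n !=set0) ->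
  (forall n, E n.+1 `<=` E n) -> \bigcap_n E n !=set0.
Proof.
move=> cE E0 decE.
have /choice[u Eu] : forall n, exists x, E n x by move=> n; exact: E0.
have [x [_ xu]] := Kc (fmap_proper_filter u (eventually_filter)) filterT.
exists x => n _; apply: cE => V xV.
have sub k : E (k + n)%N `<=` E n.
  by elim: k => // k IH y; rewrite addSn => /decE /IH.
have uE : (u @ \oo) (E n).
  by exists n => // m /= nm; apply: (sub (m - n)%N); rewrite subnK.
exact: xu uE xV.
Qed.

(** A countable family separating points from closed sets: for each [n], the balls of radius
    [1/(n+1)] about a finite net of that mesh. *)
Lemma metrizable_network : [set: K] !=set0 -> metrizable R K ->
  exists V : nat -> set K, forall (F : set K) (x : K), closed F -> ~ F x ->
    exists2 k, V k x & V k `&` F = set0.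
Proof.
move=> [x0 _] [d [d0 dE dC dT dn]].
pose Kp : ptopologicalType := HB.pack K (isPointed.Build K x0).
have cov : @cover_compact Kp setT by rewrite -compact_cover.
have /choice[D HD] : forall n, exists s : seq K, forall x,
    exists2 c, c \in s & d c x < n.+1%:R^-1.
  move=> n; have [|x _|D _ HD] := cov K setT
      (fun c => (interior [set y | d c y < n.+1%:R^-1] : set Kp)).
  - by move=> i _; exact: open_interior.
  - exists x => //; rewrite /interior /= /nbhs /=.
    change (nbhs (x : K) [set y | d x y < n.+1%:R^-1]).
    by rewrite dn; exists n.+1%:R^-1; rewrite /= ?invr_gt0.
  exists (enum_fset D) => x; have [c cD cx] := HD x I.
  by exists c => //; exact: interior_subset cx.
pose V k : set K := if choice.unpickle k is Some (n, i)
  then [set y | d (nth x0 (D n) i) y < n.+1%:R^-1] else set0.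
exists V => F x cF Fx.
have : nbhs x (~` F) by apply: open_nbhs_nbhs; split=> //; exact: closed_openC.
rewrite dn => -[e /= e0 eF].
(* With radius below [e / 2], a ball containing [x] lies within distance [e] of [x]. *)
have [n _ Hn] := (cvgrPdist_lt _ _).1 (@cvg_harmonic R) _ (divr_gt0 e0 (ltr0n _ 2)).
have := Hn n (leqnn n); rewrite sub0r normrN => /(le_lt_trans (ler_norm _)).
rewrite /harmonic /= => ne.
have [c cD cx] := HD n x.
exists (choice.pickle (n, index c (D n))); rewrite /V choice.pickleK nth_index //.
apply/seteqP; split=> // y [/= cy Fy].
apply: (eF y _ Fy) => /=.
apply: le_lt_trans (dT x c y) _; rewrite dC (splitr e).
by apply: ltrD; apply: lt_trans ne.
Qed.

Variable B : set (K -> R[i]^o).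
Hypothesis uB : uniform_subalgebra B.
Implicit Types (p q g : K -> R[i]^o).

Lemma closed_peaking p : peaking B p -> closed (peak_set p).
Proof.
by have [[cB _ _ _] _ _] := uB; move=> [/cB cp p1 pE _]; exact: closed_peak_set.
Qed.

(** Used twice: the third clause, with [p] constant, places a peak set inside the maximum set of
    [|g|]; the fourth makes [g] constant on a minimal peak set. *)
Lemma peaking_refine p g : peaking B p -> B g ->
  exists q, [/\ peaking B q, peak_set q `<=` peak_set p,
    forall z w, peak_set q z -> peak_set p w -> normc (g w) <= normc (g z) &
    forall z w, peak_set q z -> peak_set q w -> g z = g w].
Proof.
move=> pp Bg; have [Bp p1 pE p0] := pp; have [[cB BD BZ _] Bc _] := uB.
have [x0 px0 gmax] := compact_max_continuous p0
  (closed_compact Kc (closed_peaking pp)) (continuous_normc (cB _ Bg)).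
have [g0|g0] := eqVneq (g x0) 0.
  have gz z : peak_set p z -> g z = 0.
    move=> /gmax; rewrite g0 normc0 => gz.
    by apply/eq0_normc/eqP; rewrite eq_le gz normc_ge0.
  exists p; split=> // [z w /gz -> /gz -> //|z w /gz -> /gz -> //].
(* [h] is controlled by [normc_midpoint1] only on the peak set of [p]; [peaking_extension] then
   replaces it by a [q] equal to it there and of modulus below 1 elsewhere. *)
pose h x : R[i]^o := (1 + g x / g x0) / 2.
have Bh : B h.
  have -> : h = (2^-1 : R[i]) \*: (cst 1 \+ ((g x0)^-1 \*: g)).
    apply/funext => x; rewrite /h /= mulrC; congr (_ * (_ + _)); exact: mulrC.
  exact/BZ/BD/BZ.
have hP z : peak_set p z -> normc (h z) <= 1 /\ (normc (h z) = 1 -> g z = g x0).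
  move=> /gmax gz; have [|h1 hE] := @normc_midpoint1 R (g z / g x0).
    rewrite normcM normcV ler_pdivrMr ?mul1r //.
    by rewrite lt_neqAle normc_ge0 andbT eq_sym; apply: contra_neq g0 => /eq0_normc.
  by split=> // /hE /(congr1 ( *%R^~ (g x0))); rewrite divfK // mul1r.
have [q Bq [qh q1]] := peaking_extension Kc uB pp Bh (fun x px => (hP x px).1).
have hx0 : h x0 = 1 by rewrite /h divff // divff // pnatr_eq0.
have qp z : normc (q z) = 1 -> peak_set p z.
  by move=> qz; apply: contrapT => /q1; rewrite qz ltxx.
have qg z : peak_set q z -> peak_set p z /\ g z = g x0.
  move=> qz; have pz : peak_set p z by apply: qp; rewrite qz normc1.
  by split=> //; apply: (hP z pz).2; rewrite -qh // qz normc1.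
exists q; split.
- split=> // [z|z qz|].
  + have [pz|pz] := pselect (p z = 1); last exact/ltW/q1.
    by rewrite qh //; exact: (hP z pz).1.
  + have pz := qp z qz; have := qz; rewrite qh // => /(hP z pz).2 gz.
    by rewrite /h gz -/(h x0).
  + by exists x0; rewrite qh.
- by move=> z /qg[].
- by move=> z w /qg[_ ->]; exact: gmax.
- by move=> z w /qg[_ ->] /qg[_ ->].
Qed.

(** The weighted sum of the [p n] is 1 on the intersection; off it some term has modulus below 1.
    Compactness makes the decreasing intersection nonempty. *)
Lemma peaking_bigcap (p : nat -> K -> R[i]^o) : (forall n, peaking B (p n)) ->
  (forall n, peak_set (p n.+1) `<=` peak_set (p n)) ->
  exists2 q, peaking B q & peak_set q = \bigcap_n peak_set (p n).
Proof.
move=> pp dec.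
have p1 n x : normc (p n x) <= 1 by have [_ + _ _] := pp n; apply.
have [x px] := compact_decreasing_nonempty (fun n => closed_peaking (pp n))
  (fun n => let: And4 _ _ _ p0 := pp n in p0) dec.
have Bp n : B (p n) by have [] := pp n.
have [q Bq qP] := uniform_subalgebra_series uB Bp p1.
have q1 z : (\bigcap_n peak_set (p n)) z -> q z = 1.
  by move=> pz; apply: (qP z).1 => n; exact: pz.
have qlt z : ~ (\bigcap_n peak_set (p n)) z -> normc (q z) < 1.
  move=> /existsNP[m /not_implyP[_ pmz]].
  have := @weighted_sum_lt1 R (fun i => normc (p i z)) m (fun i => p1 i z).
  move=> /((qP z).2 _ m.+1) /le_lt_trans; apply.
  rewrite gtrBl mulr_gt0 ?exprn_gt0 ?invr_gt0 // subr_gt0 lt_neqAle p1 andbT.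
  by apply/eqP; have [_ _ + _] := pp m => /[apply].
have qE z : normc (q z) = 1 -> (\bigcap_n peak_set (p n)) z.
  by move=> qz; apply: contrapT => /qlt; rewrite qz ltxx.
exists q; first split=> //.
- move=> z; have [/q1 ->|/qlt/ltW //] := pselect ((\bigcap_n peak_set (p n)) z).
  by rewrite normc1.
- by move=> z /qE /q1.
- by exists x; exact: q1.
- apply/seteqP; split=> z; last exact: q1.
  by move=> qz; apply: qE; rewrite qz normc1.
Qed.

(** A greedy construction: stage [k] shrinks the current peak set to one avoiding [V k] whenever a
    smaller peak set does. If a peak set inside the intersection missed one of its points [x], some
    [V k] containing [x] would avoid it, and stage [k] would have removed [x]. *)
Lemma peaking_minimal p : metrizable R K -> peaking B p ->
  exists q, [/\ peaking B q, peak_set q `<=` peak_set p &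
    forall r, peaking B r -> peak_set r `<=` peak_set q ->
      peak_set q `<=` peak_set r].
Proof.
move=> mK pp; have [_ _ _ [x0 _]] := pp.
have [V HV] := metrizable_network (ex_intro _ x0 I) mK.
pose P := {p | peaking B p}.
pose avoids k (p : P) := peak_set (sval p) `&` V k = set0.
have /choice[step Hstep] : forall kp : nat * P, exists q : P,
    peak_set (sval q) `<=` peak_set (sval kp.2) /\
    forall r : P, peak_set (sval r) `<=` peak_set (sval kp.2) ->
      avoids kp.1 r -> avoids kp.1 q.
  move=> [k p']; have [[r rp rV]|no] := pselect (exists2 r : P,
    peak_set (sval r) `<=` peak_set (sval p') & avoids k r); first by exists r.
  by exists p'; split=> // r rp rV; case: no; exists r.
pose s := fix s n : P := if n is m.+1 then step (m, s m) else exist _ p pp.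
have sdec n : peak_set (sval (s n.+1)) `<=` peak_set (sval (s n)).
  exact: (Hstep (n, s n)).1.
have [q pq qE] := peaking_bigcap (fun n => proj2_sig (s n)) sdec.
exists q; split=> //; first by rewrite qE => z /(_ 0%N I).
move=> r pr rq x qx; apply: contrapT => rx.
have [k Vx Vr] := HV _ _ (closed_peaking pr) rx.
have : avoids k (s k.+1).
  apply: ((Hstep (k, s k)).2 (exist _ r pr)); last by rewrite /avoids setIC.
  by move=> z /= /rq; rewrite qE => /(_ k I).
rewrite /avoids => /seteqP[/(_ x) + _]; apply; split=> //.
by move: qx; rewrite qE => /(_ k.+1 I).
Qed.

Lemma peaking_point f : [set: K] !=set0 -> metrizable R K -> separating B ->
  B f -> exists x, (forall y, normc (f y) <= normc (f x)) /\
    exists2 q, peaking B q & peak_set q = [set x].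
Proof.
move=> [x0 _] mK sB Bf.
(* The peak set of [cst 1] is all of [K], so refining it by [f] yields global maxima of [|f|]. *)
have p1 : peaking B (cst 1).
  have [_ Bc _] := uB.
  split=> // [x|]; [by rewrite normc1 | by exists x0].
have [p [pp _ pmax _]] := peaking_refine p1 Bf.
have [q [pq qp qmin]] := peaking_minimal mK pp.
have [_ _ _ [x qx]] := pq.
exists x; split=> [y|]; first by apply: pmax => //; exact: qp.
exists q => //; apply/seteqP; split=> [y qy|y -> //].
apply: contrapT => /sB[g Bg gyx].
have [r [pr rq _ rg]] := peaking_refine pq Bg.
by apply: gyx; apply: rg; apply: (qmin r).
Qed.

End peak_sets.

(** * Peak points and boundaries for [log|B|] *)

Section log_abs.
Variables (R : realType) (K : topologicalType).
Implicit Types (f : K -> R[i]^o) (B : set (K -> R[i]^o)).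

(** [lne] preserves and reflects order on nonnegative reals, including 0, which goes to -oo. *)
Lemma max_points_log_abs f :
  max_points (fun x => lne (normc (f x))%:E) =
  [set x | forall y, normc (f y) <= normc (f x)].
Proof.
have leE a b : 0 <= a -> 0 <= b -> (lne a%:E <= lne b%:E)%E = (a <= b :> R).
  by move=> a0 b0; rewrite lee_lne ?in_itv /= ?lee_fin ?leey ?a0 ?b0.
apply/seteqP; split=> x fx y; have := fx y.
  by rewrite leE ?normc_ge0.
by rewrite leE ?normc_ge0.
Qed.

Lemma peaking_peak_points B p x : peaking B p -> peak_set p = [set x] ->
  peak_points (log_abs B) x.
Proof.
move=> [Bp p1 pE _] px; have px1 : p x = 1 by rewrite -[_ = 1]/(peak_set p x) px.
exists (fun x => lne (normc (p x))%:E); first by exists p.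
rewrite max_points_log_abs -px; apply/seteqP; split=> y /= py.
  by apply: pE; apply/eqP; rewrite eq_le p1 /= -(normc1 R) -px1 py.
by move=> z; rewrite py normc1 p1.
Qed.

Lemma peak_points_sub_boundary (A : set (K -> \bar R)) S :
  boundary A S -> peak_points A `<=` S.
Proof. by move=> bS x [f Af fx]; have := bS _ Af; rewrite fx => -[y [Sy <-]]. Qed.

End log_abs.

Theorem corollary3p7 (R : realType) (K : topologicalType) (J : Type)
    (B : J -> set (K -> R[i]^o)) :
  [set: K] !=set0 ->
  compact [set: K] ->
  hausdorff_space K ->
  metrizable R K ->
  (forall j, uniform_subalgebra (B j)) ->
  (forall j, separating (B j)) ->
  let L := log_abs (\bigcup_j B j) in
  exists m : set K,
    [/\ is_minimal_boundary L m,
        m = peak_points L &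
        shilov_boundary L = closure (peak_points L)].
Proof.
move=> K0 Kc _ mK uB sB L.
have bP : boundary L (peak_points L).
  move=> _ [f [j _ Bf] <-].
  have [x [fx [q [Bq q1 qE q0] qx]]] := peaking_point Kc (uB j) K0 mK (sB j) Bf.
  exists x; split; last by rewrite max_points_log_abs.
  (* Apart from membership, [peaking] does not depend on the algebra, so a function peaking for
     [B j] also peaks for the union. *)
  by apply: peaking_peak_points qx; split=> //; exists j.
exists (peak_points L); split=> //.
  by split=> // S; exact: peak_points_sub_boundary.
(* The closure of the peak points is itself a closed boundary; conversely, every closed boundary
   contains the peak points, hence their closure. *)
apply/seteqP; split=> x.
  apply; split; first exact: closed_closure.
  by move=> f /bP[y [Py fy]]; exists y; split=> //; exact: subset_closure.
move=> Px S [cS /peak_points_sub_boundary PS].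
by apply: cS; exact: closure_subset Px.
Qed.
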